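(* Let $(X,d)$ and $(Y,\rho)$ be two metric spaces and let $(\widehat{X},\widehat{d})$ denote the completion of $X$. Then the following conditions are equivalent. (1) Every Cauchy continuous function $f:(X,d)\to(Y,\rho)$ is ward continuous. (2) Every real valued Cauchy continuous function defined on $X$ is ward continuous. (3) Every Bourbaki quasi-Cauchy sequence in $X$ has a Cauchy subsequence. (4) $(\widehat{X},\widehat{d})$ is Bourbaki quasi-complete. (5) Any two Cauchy separated sets cannot be connected through a quasi-Cauchy sequence. (6) For a complete subset $A$ and a closed subset $B$ of $X$ with $A,B\neq\emptyset$ and $A\cap B=\emptyset$, $A$ and $B$ cannot be connected through a quasi-Cauchy sequence.
   Context: A sequence $(x_n)$ in a metric space $(X,d)$ is quasi-Cauchy if for every $\varepsilon>0$ there is $n_0$ such that $d(x_{n+1},x_n)<\varepsilon$ for all $n\ge n_0$. A function between metric spaces is Cauchy continuous if it maps Cauchy sequences to Cauchy sequences, and ward continuous if it maps quasi-Cauchy sequences to quasi-Cauchy sequences. For $\varepsilon>0$ and $p\in X$, $B^\infty_\varepsilon(p)$ is the set of points $q\in X$ for which there are finitely many points $p=p_0,p_1,\dots,p_n=q$ in $X$ with $d(p_{i-1},p_i)<\varepsilon$ for $i=1,\dots,n$. A sequence $(x_n)$ is Bourbaki quasi-Cauchy in $X$ if for every $\varepsilon>0$ there exist $n_0\in\mathbb{N}$ and $p\in X$ such that $x_n\in B^\infty_\varepsilon(p)$ for every $n\ge n_0$. A metric space is Bourbaki quasi-complete if every Bourbaki quasi-Cauchy sequence in it has a cluster point in it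 (i.e. a subsequence converging in it). Two non-empty subsets $A,B$ of $X$ are Cauchy separated if for each Cauchy sequence $(x_n)$ in $X$ the sets $\{n:x_n\in A\}$ and $\{n:x_n\in B\}$ are not both infinite. Two non-empty subsets $A,B$ of $X$ are connected through a quasi-Cauchy sequence if there is a quasi-Cauchy sequence $(x_n)$ in $X$ and a subsequence $(x_{n_k})$ such that $x_{n_k}\in A$ and $x_{n_k+1}\in B$ for all $k$. *)

(* Defs.v *)
From HB Require Import structures.
From mathcomp Require Import all_boot all_order all_algebra.
From mathcomp Require Import all_classical all_reals all_analysis.

Set Implicit Arguments.
Unset Strict Implicit.
Unset Printing Implicit Defensive.

Import Order.TTheory GRing.Theory Num.Theory.
Import numFieldNormedType.Exports.

Local Open Scope classical_set_scope.
Local Open Scope ring_scope.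

Definition cauchy_seq (R : realType) (X : metricType R) (x : nat -> X) : Prop :=
  cauchy (x @ \oo).

Definition quasi_cauchy (R : realType) (X : metricType R) (x : nat -> X) : Prop :=
  forall e : R, 0 < e ->
    exists n0 : nat, forall n : nat, (n0 <= n)%N -> mdist (x n.+1) (x n) < e.

Definition cauchy_continuous (R : realType) (X Y : metricType R) (f : X -> Y) : Prop :=
  forall x : nat -> X, cauchy_seq x -> cauchy_seq (f \o x).

Definition ward_continuous (R : realType) (X Y : metricType R) (f : X -> Y) : Prop :=
  forall x : nat -> X, quasi_cauchy x -> quasi_cauchy (f \o x).

(* The chain p_0, ..., p_n is [p :: s], with n = size s; s may be empty. *)
Definition chain_ball (R : realType) (X : metricType R) (p : X) (e : R) : set X :=
  [set q | exists2 s : seq X,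
             path (fun a b : X => mdist a b < e) p s & last p s = q].

Definition bourbaki_quasi_cauchy (R : realType) (X : metricType R)
    (x : nat -> X) : Prop :=
  forall e : R, 0 < e ->
    exists (n0 : nat) (p : X), forall n : nat, (n0 <= n)%N -> chain_ball p e (x n).

Definition is_subseq_index (k : nat -> nat) : Prop :=
  forall m n : nat, (m < n)%N -> (k m < k n)%N.

Definition bourbaki_quasi_complete (R : realType) (X : metricType R) : Prop :=
  forall x : nat -> X, bourbaki_quasi_cauchy x ->
    exists (k : nat -> nat) (l : X), is_subseq_index k /\ (x \o k) @ \oo --> l.

Definition cauchy_separated (R : realType) (X : metricType R) (A B : set X) : Prop :=
  forall x : nat -> X, cauchy_seq x ->
    ~ (infinite_set [set n | A (x n)] /\ infinite_set [set n | B (x n)]).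

Definition quasi_cauchy_connected (R : realType) (X : metricType R)
    (A B : set X) : Prop :=
  exists (x : nat -> X) (k : nat -> nat),
    [/\ quasi_cauchy x, is_subseq_index k &
        forall j : nat, A (x (k j)) /\ B (x (k j).+1)].

Definition complete_set (R : realType) (X : metricType R) (A : set X) : Prop :=
  forall x : nat -> X, (forall n, A (x n)) -> cauchy_seq x ->
    exists2 l : X, A l & x @ \oo --> l.

(* A completion is unique up to isometry, so it is characterized here by its
   defining properties rather than by one particular construction. *)
Definition is_completion (R : realType) (X Xhat : metricType R)
    (iota : X -> Xhat) : Prop :=
  [/\ forall a b : X, mdist (iota a) (iota b) = mdist a b,
      dense (range iota) &
      complete_set [set: Xhat]].

(* Main.v *)
(* The implications are (2) => (5) => (6) => (3) => (1) => (2) and (3) <=> (4).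
   (2) => (5): x |-> d(x,A) / (d(x,A) + d(x,B)) separates Cauchy separated sets.
   (5) => (6): a complete set and a disjoint closed set are Cauchy separated.
   (6) => (3): a Bourbaki quasi-Cauchy sequence v without Cauchy subsequence can
   be thinned out, together with points z_j <> v_j at distance < 1/(j+1) from
   v_j, so that {v_j} and {z_j} are disjoint; both are complete, and ever finer
   chains v_j, z_j, ..., v_(j+1) concatenate to a quasi-Cauchy sequence
   connecting them.
   (3) => (1): a subsequence along which x_n and x_(n+1) have images at distance
   >= e is Bourbaki quasi-Cauchy; interleave a Cauchy subsequence of it with its
   shift.
   (3) <=> (4): chains in the completion are approximated by chains in X. *)

Require Import Defs.
From HB Require Import structures.
From mathcomp Require Import all_boot all_order all_algebra.
From mathcomp Require Import all_classical all_reals all_analysis.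
From mathcomp Require Import lra.

Set Implicit Arguments.
Unset Strict Implicit.
Unset Printing Implicit Defensive.

Import Order.TTheory GRing.Theory Num.Theory.
Import numFieldNormedType.Exports.

Local Open Scope classical_set_scope.
Local Open Scope ring_scope.

(** * Extraction of subsequences of indices *)

Lemma subseq_indexS (k : nat -> nat) :
  (forall n, (k n < k n.+1)%N) -> is_subseq_index k.
Proof. by move=> kS m n; apply: (homo_ltn ltn_trans kS). Qed.

Lemma subseq_index_ge (k : nat -> nat) : is_subseq_index k ->
  forall n, (n <= k n)%N.
Proof.
by move=> kI; elim=> // n IH; apply: leq_ltn_trans IH _; exact: kI.
Qed.

Lemma subseq_index_comp (k l : nat -> nat) :
  is_subseq_index k -> is_subseq_index l -> is_subseq_index (k \o l).
Proof. by move=> kI lI m n mn; apply/kI/lI. Qed.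

Lemma frequently_subseq (P : nat -> Prop) :
  (forall N, exists2 n, (N <= n)%N & P n) ->
  exists2 k, is_subseq_index k & forall j, P (k j).
Proof.
move=> freqP.
have /choice[g gP] N : exists n, (N <= n)%N /\ P n.
  by have [n] := freqP N; exists n.
exists (fun j => iter j (g \o succn) (g 0%N)).
  by apply: subseq_indexS => n /=; have [] := gP (iter n (g \o succn) (g 0%N)).+1.
by case=> [|j]; exact: (gP _).2.
Qed.

Lemma eventually_rel_subseq (P : nat -> nat -> Prop) :
  (forall i, exists N, forall m, (N <= m)%N -> P i m) ->
  exists2 k, is_subseq_index k & forall i j, (i < j)%N -> P (k i) (k j).
Proof.
(* [M n] exceeds [n] and dominates [N i] for every [i <= n], so each new index lies past the
   thresholds of all earlier ones. *)
move=> /choice[N NP]; pose M n := (n + \sum_(i < n.+1) N i).+1.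
pose k j := iter j M 0%N.
have kI : is_subseq_index k.
  by apply: subseq_indexS => n; rewrite /k /= /M ltnS leq_addr.
exists k => // i [//|j]; rewrite ltnS => ij.
have kij : (k i < (k j).+1)%N.
  by move: ij; rewrite leq_eqVlt ltnS => /predU1P[->//|/kI/ltnW].
apply: NP; rewrite [k j.+1]/= -/(k j) /M leqW// (bigD1 (Ordinal kij))//=.
by rewrite addnCA leq_addr.
Qed.

Lemma infinite_frequently (P : nat -> Prop) :
  infinite_set [set n | P n] -> forall N, exists2 n, (N <= n)%N & P n.
Proof.
move=> infP N; apply: contrapT => noP; apply: infP.
apply: (sub_finite_set _ (finite_II N)) => n /= Pn.
by rewrite ltnNge; apply/negP => Nn; apply: noP; exists n.
Qed.

Lemma frequently_infinite (P : nat -> Prop) :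
  (forall N, exists2 n, (N <= n)%N & P n) -> infinite_set [set n | P n].
Proof.
move=> /frequently_subseq[k kI kP] finP.
apply: infinite_nat.
have -> : [set: nat] = k @^-1` [set n | P n] by apply/seteqP; split=> n _ //=.
apply: finite_preimage finP => i j _ _ kij.
by case: (ltngtP i j) => // /kI; rewrite kij ltnn.
Qed.

(** * Cauchy, convergent and asymptotic sequences *)

Section MetricSequences.
Variables (R : realType).
Implicit Types X Y : metricType R.

Lemma cauchy_seqP X (x : nat -> X) : cauchy_seq x <->
  forall e : R, 0 < e -> exists N, forall m n, (N <= m)%N -> (N <= n)%N ->
    mdist (x m) (x n) < e.
Proof.
rewrite /cauchy_seq -cauchy_ballP; split=> [cx e e0|cx e e0].
  have := cx e e0; rewrite near_map2 => -[[A B] /= [[N1 _ N1A] [N2 _ N2B]] AB].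
  exists (maxn N1 N2) => m n; rewrite !geq_max => /andP[m1 _] /andP[_ n2].
  have := AB (m, n) (conj (N1A _ m1) (N2B _ n2)).
  by rewrite /= ballEmdist.
rewrite near_map2; have [N NP] := cx e e0.
exists ([set n | (N <= n)%N], [set n | (N <= n)%N]) => /=.
  by split; exists N.
by move=> [m n] /= [mN nN]; rewrite ballEmdist; exact: NP.
Qed.

Lemma cvg_seqP X (x : nat -> X) (l : X) : x @ \oo --> l <->
  forall e : R, 0 < e -> exists N, forall n, (N <= n)%N -> mdist l (x n) < e.
Proof.
rewrite (metricType_numDomainType.cvgrPdist_lt x l).
by split=> cx e /cx [N]; exists N.
Qed.

Lemma cauchy_subseq X (x : nat -> X) k : is_subseq_index k ->
  cauchy_seq x -> cauchy_seq (x \o k).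
Proof.
move=> kI /cauchy_seqP cx; apply/cauchy_seqP => e /cx[N NP].
exists N => m n mN nN.
by apply: NP; apply: leq_trans (subseq_index_ge kI _).
Qed.

Lemma cvg_cauchy_seq X (x : nat -> X) (l : X) : x @ \oo --> l -> cauchy_seq x.
Proof.
move=> /cvg_seqP cx; apply/cauchy_seqP => e e0.
have [|N NP] := cx (e / 2); first by rewrite divr_gt0.
exists N => m n /NP xm /NP xn; rewrite (le_lt_trans (metric_triangle _ l _))//.
by rewrite metric_sym (splitr e) ltrD.
Qed.

Lemma cauchy_cluster X (x : nat -> X) (l : X) : cauchy_seq x ->
  (forall e : R, 0 < e -> forall N, exists2 n, (N <= n)%N & mdist l (x n) < e) ->
  x @ \oo --> l.
Proof.
move=> /cauchy_seqP cx lx; apply/cvg_seqP => e e0.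
have e2 : 0 < e / 2 by rewrite divr_gt0.
have [N NP] := cx _ e2; have [m mN lm] := lx _ e2 N.
exists N => n nN; rewrite (le_lt_trans (metric_triangle _ (x m) _))//.
by rewrite (splitr e) ltrD// NP.
Qed.

Definition asymptotic X (a b : nat -> X) : Prop :=
  forall e : R, 0 < e -> exists N, forall n, (N <= n)%N -> mdist (a n) (b n) < e.

Lemma asymptotic_sym X (a b : nat -> X) : asymptotic a b -> asymptotic b a.
Proof.
by move=> ab e /ab[N NP]; exists N => n /NP; rewrite metric_sym.
Qed.

Lemma asymptotic_subseq X (a b : nat -> X) k : is_subseq_index k ->
  asymptotic a b -> asymptotic (a \o k) (b \o k).
Proof.
move=> kI ab e /ab[N NP]; exists N => n nN.
by apply: NP; apply: leq_trans (subseq_index_ge kI _).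
Qed.

Lemma asymptotic_cvg X (a b : nat -> X) (l : X) : asymptotic a b ->
  a @ \oo --> l -> b @ \oo --> l.
Proof.
move=> ab /cvg_seqP al; apply/cvg_seqP => e e0.
have e2 : 0 < e / 2 by rewrite divr_gt0.
have [N NP] := ab _ e2; have [M MP] := al _ e2.
exists (maxn N M) => n; rewrite geq_max => /andP[/NP abn /MP aln].
by rewrite (le_lt_trans (metric_triangle _ (a n) _))// (splitr e) ltrD.
Qed.

Lemma asymptotic_cauchy X (a b : nat -> X) : asymptotic a b ->
  cauchy_seq a -> cauchy_seq b.
Proof.
move=> ab /cauchy_seqP ca; apply/cauchy_seqP => e e0.
have e3 : 0 < e / 3 by rewrite divr_gt0.
have [N NP] := ab _ e3; have [M MP] := ca _ e3.
exists (maxn N M) => m n; rewrite !geq_max => /andP[mN mM] /andP[nN nM].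
rewrite (le_lt_trans (metric_triangle _ (a m) _))//.
apply: le_lt_trans (lerD (lexx _) (metric_triangle _ (a n) _)) _.
have := NP _ mN; have := NP _ nN; have := MP _ _ mM nM.
by rewrite (metric_sym (b m)); lra.
Qed.

Lemma asymptotic_le_inv X (a b : nat -> X) :
  (forall n, mdist (a n) (b n) < n.+1%:R^-1) -> asymptotic a b.
Proof.
move=> ab e e0.
have [N _ NP] := near_infty_natSinv_lt (PosNum e0).
by exists N => n /NP; apply: lt_trans.
Qed.

Lemma asymptotic_trans X (a b c : nat -> X) : asymptotic a b ->
  asymptotic b c -> asymptotic a c.
Proof.
move=> ab bc e e0; have e2 : 0 < e / 2 by rewrite divr_gt0.
have [N NP] := ab _ e2; have [M MP] := bc _ e2.
exists (maxn N M) => n; rewrite geq_max => /andP[/NP abn /MP bcn].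
by rewrite (le_lt_trans (metric_triangle _ (b n) _))// (splitr e) ltrD.
Qed.

Definition interleave (T : Type) (a b : nat -> T) (n : nat) : T :=
  if odd n then b n./2 else a n./2.

Lemma interleave_even (T : Type) (a b : nat -> T) n :
  interleave a b n.*2 = a n.
Proof. by rewrite /interleave odd_double doubleK. Qed.

Lemma interleave_odd (T : Type) (a b : nat -> T) n :
  interleave a b n.*2.+1 = b n.
Proof. by rewrite /interleave /= odd_double uphalf_double. Qed.

Lemma cauchy_interleave X (a b : nat -> X) : asymptotic a b ->
  cauchy_seq a -> cauchy_seq (interleave a b).
Proof.
move=> ab /cauchy_seqP ca; apply/cauchy_seqP => e e0.
have e3 : 0 < e / 3 by rewrite divr_gt0.
have [N NP] := ab _ e3; have [M MP] := ca _ e3.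
(* Each late term is compared with [a] at half its index; the distance is 0 at even indices and is
   controlled by [ab] at odd ones. *)
have near_a n : ((maxn N M).*2 <= n)%N ->
    mdist (interleave a b n) (a n./2) < e / 3.
  move=> /half_leq; rewrite doubleK geq_max => /andP[nN _].
  by rewrite /interleave; case: odd; rewrite ?mdistxx// metric_sym NP.
exists (maxn N M).*2 => m n mN nN.
rewrite (le_lt_trans (metric_triangle _ (a m./2) _))//.
apply: le_lt_trans (lerD (lexx _) (metric_triangle _ (a n./2) _)) _.
have := near_a _ mN; have := near_a _ nN.
have /half_leq := mN; have /half_leq := nN.
rewrite doubleK !geq_max => /andP[_ nM] /andP[_ mM].
by have := MP _ _ mM nM; rewrite (metric_sym (interleave a b n)); lra.
Qed.

Lemma cauchy_interleave_asymptotic X (a b : nat -> X) :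
  cauchy_seq (interleave a b) -> asymptotic a b.
Proof.
move=> /cauchy_seqP c e /c[N NP]; exists N => n nN.
have nN2 : (N <= n.*2)%N by rewrite -addnn (leq_trans nN)// leq_addr.
by have := NP _ _ nN2 (leqW nN2); rewrite interleave_even interleave_odd.
Qed.

(* Interleaving two asymptotic sequences gives a single sequence to which
   Cauchy continuity applies. *)
Lemma cauchy_continuous_asymptotic X Y (f : X -> Y) (a b : nat -> X) :
  cauchy_continuous f -> asymptotic a b -> cauchy_seq a ->
  asymptotic (f \o a) (f \o b).
Proof.
move=> fc ab ca; apply: cauchy_interleave_asymptotic.
have -> : interleave (f \o a) (f \o b) = f \o interleave a b.
  by apply/funext => n; rewrite /interleave /=; case: odd.
by apply: fc; exact: cauchy_interleave.
Qed.

Lemma complete_set_closed X (A : set X) : complete_set A -> closed A.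
Proof.
move=> Ac l Al.
have /choice[a aP] n : exists a, A a /\ mdist l a < n.+1%:R^-1.
  have [|a [Aa la]] := Al (ball l n.+1%:R^-1).
    by apply: nbhsx_ballx; rewrite invr_gt0.
  by exists a; split => //; move: la; rewrite ballEmdist.
have al : a @ \oo --> l.
  (* Convergence to [l] amounts to being asymptotic to the constant sequence [l]. *)
  apply/cvg_seqP; apply: (asymptotic_le_inv (a := fun=> l)) => n.
  by have [] := aP n.
have [l' Al' al'] := Ac a (fun n => (aP n).1) (cvg_cauchy_seq al).
suff -> : l = l' by [].
have hausX : hausdorff_space X by exact: metric_hausdorff.
exact: (cvg_unique hausX al al').
Qed.

Lemma closed_frequently X (B : set X) (x : nat -> X) (l : X) : closed B ->
  x @ \oo --> l -> (forall N, exists2 n, (N <= n)%N & B (x n)) -> B l.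
Proof.
move=> Bc xl Bx; apply: Bc => U /xl[N _ NU].
by have [n nN Bn] := Bx N; exists (x n); split => //; exact: NU.
Qed.

End MetricSequences.

(** * Chains and Bourbaki quasi-Cauchy sequences *)

Section Chains.
Variables (R : realType).
Implicit Types X Y : metricType R.

Lemma chain_ball_refl X (p : X) e : chain_ball p e p.
Proof. by exists [::]. Qed.

Lemma chain_ball_step X (p q : X) e : mdist p q < e -> chain_ball p e q.
Proof. by move=> pq; exists [:: q] => //=; rewrite pq. Qed.

Lemma chain_ball_trans X (p q r : X) e :
  chain_ball p e q -> chain_ball q e r -> chain_ball p e r.
Proof.
move=> [s ps <-] [t qt <-]; exists (s ++ t); last by rewrite last_cat.
by rewrite cat_path ps.
Qed.

Lemma chain_ball_sym X (p q : X) e : chain_ball p e q -> chain_ball q e p.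
Proof.
move=> [s + <-]; elim: s p => [|a s IH] p /=; first by move=> _; exists [::].
move=> /andP[pa /IH qa]; apply: chain_ball_trans qa _.
by apply: chain_ball_step; rewrite metric_sym.
Qed.

Lemma chain_ball_le X (p q : X) d e : d <= e ->
  chain_ball p d q -> chain_ball p e q.
Proof.
move=> de [s ps <-]; exists s => //; apply: sub_path ps => a b /=.
by move=> ab; exact: lt_le_trans de.
Qed.

(** The first point of the chain that differs from [p] is reached from [p] in a single step. *)
Lemma chain_ball_neighbor X (p q : X) e : chain_ball p e q -> q <> p ->
  exists2 z, z <> p & mdist p z < e.
Proof.
move=> [s + <-]; elim: s => [|a s IH] //= /andP[pa ps].
by have [ap|] := pselect (a = p); [rewrite ap in ps *; exact: IH|exists a].
Qed.

(** Once its steps are below [e], the sequence is itself a chain starting at [x N]. *)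
Lemma quasi_cauchy_bourbaki X (x : nat -> X) :
  quasi_cauchy x -> bourbaki_quasi_cauchy x.
Proof.
move=> xq e /xq[N NP]; exists N, (x N) => n /subnK <-.
elim: (n - N)%N => [|m IH]; first exact: chain_ball_refl.
apply: chain_ball_trans IH _; apply: chain_ball_step.
by rewrite metric_sym NP// leq_addl.
Qed.

Lemma bourbaki_subseq X (x : nat -> X) k : is_subseq_index k ->
  bourbaki_quasi_cauchy x -> bourbaki_quasi_cauchy (x \o k).
Proof.
move=> kI xb e /xb[N [p NP]]; exists N, p => n nN; apply: NP.
exact: leq_trans (subseq_index_ge kI _).
Qed.

Lemma bourbaki_ward X Y (f : X -> Y) :
  (forall x : nat -> X, bourbaki_quasi_cauchy x ->
     exists2 k, is_subseq_index k & cauchy_seq (x \o k)) ->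
  cauchy_continuous f -> ward_continuous f.
Proof.
move=> h3 fc x xq e e0; apply: contrapT => nq.
have [|k kI kP] := @frequently_subseq
    (fun n => ~ mdist (f (x n.+1)) (f (x n)) < e).
  move=> N; apply: contrapT => noN; apply: nq; exists N => n nN /=.
  by apply: contrapT => ?; apply: noN; exists n.
have [l lI cl] := h3 _ (bourbaki_subseq kI (quasi_cauchy_bourbaki xq)).
have klI := subseq_index_comp kI lI.
(* Quasi-Cauchyness makes the shifted subsequence asymptotic to the Cauchy one, so their images
   under [f] become close, against [kP]. *)
have ab : asymptotic (x \o (k \o l)) (x \o succn \o (k \o l)).
  exact/(asymptotic_subseq klI)/asymptotic_sym.
have /asymptotic_sym/(_ e e0)[N NP] := cauchy_continuous_asymptotic fc ab cl.
by apply: (kP (l N)); exact: NP.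
Qed.

(** The terms in [A] have a limit in [A]; the whole Cauchy sequence follows them to it, and
    closedness puts that limit in [B] too. *)
Lemma separated_of_complete_closed X (A B : set X) : complete_set A ->
  closed B -> A `&` B = set0 -> cauchy_separated A B.
Proof.
move=> Ac Bc AB0 x cx [/infinite_frequently Ax /infinite_frequently Bx].
have [k kI kA] := frequently_subseq Ax.
have [l Al /cvg_seqP xkl] := Ac _ kA (cauchy_subseq kI cx).
have xl : x @ \oo --> l.
  apply: (cauchy_cluster cx) => e /xkl[M MP] N; exists (k (maxn M N)).
    exact: leq_trans (leq_maxr _ _) (subseq_index_ge kI _).
  exact/MP/leq_maxl.
have : (A `&` B) l by split => //; exact: closed_frequently xl Bx.
by rewrite AB0.
Qed.

(** * Sequences without Cauchy subsequences *)

Definition no_cauchy_subseq X (x : nat -> X) : Prop :=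
  forall k, is_subseq_index k -> ~ cauchy_seq (x \o k).

Lemma no_cauchy_subseq_comp X (x : nat -> X) k : is_subseq_index k ->
  no_cauchy_subseq x -> no_cauchy_subseq (x \o k).
Proof. by move=> kI xn l lI; exact: xn (subseq_index_comp kI lI). Qed.

Lemma no_cauchy_subseq_asymptotic X (a b : nat -> X) : asymptotic a b ->
  no_cauchy_subseq a -> no_cauchy_subseq b.
Proof.
move=> ab an k kI; have := asymptotic_subseq kI (asymptotic_sym ab).
by move=> /asymptotic_cauchy bk /bk; exact: an.
Qed.

(** A value taken infinitely often would give a constant subsequence. *)
Lemma no_cauchy_subseq_neq X (x : nat -> X) p : no_cauchy_subseq x ->
  exists N, forall n, (N <= n)%N -> p <> x n.
Proof.
move=> xn; apply: contrapT => noN.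
have [|k kI kP] := @frequently_subseq (fun n => p = x n).
  move=> N; apply: contrapT => nN; apply: noN; exists N => n Nn pxn.
  by apply: nN; exists n.
apply: (xn _ kI); apply/cauchy_seqP => e e0; exists 0%N => m n _ _ /=.
by rewrite -!kP mdistxx.
Qed.

(** A Cauchy sequence in the range either returns to one index of [a] infinitely often, and
    converges to that term, or visits indices tending to infinity, and then shares a subsequence
    with [a]. *)
Lemma no_cauchy_subseq_complete X (a : nat -> X) :
  no_cauchy_subseq a -> complete_set (range a).
Proof.
move=> an w /= wa cw.
have /choice[g gP] n : exists i, a i = w n by have [i _] := wa n; exists i.
have [[i iP]|noi] := pselect (exists i, forall N, exists2 n, (N <= n)%N & g n = i).
  exists (a i); first by exists i.
  apply: (cauchy_cluster cw) => e e0 N; have [n nN gni] := iP N.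
  by exists n => //; rewrite -gP gni mdistxx.
have g_neq i : exists N, forall n, (N <= n)%N -> g n <> i.
  apply: contrapT => noN; apply: noi; exists i => N; apply: contrapT => non.
  by apply: noN; exists N => n nN gni; apply: non; exists n.
have g_gt i : exists N, forall n, (N <= n)%N -> (i < g n)%N.
  elim: i => [|i [N NP]].
    by have [N NP] := g_neq 0%N; exists N => n /NP /eqP; rewrite lt0n.
  have [M MP] := g_neq i.+1; exists (maxn N M) => n.
  by rewrite geq_max => /andP[/NP ign /MP/eqP]; rewrite ltn_neqAle ign andbT eq_sym.
(* Thinning makes the visited indices strictly increasing, so [w \o k] is also a subsequence of
   [a]. *)
have [k kI kP] := eventually_rel_subseq (fun i => g_gt (g i)).
have gkI : is_subseq_index (g \o k) by move=> i j /kP.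
have /an : is_subseq_index (g \o k) by [].
case; have -> : a \o (g \o k) = w \o k by apply/funext => j /=.
exact: cauchy_subseq.
Qed.

(* The indices (j, i) run through the j-th chain [:: a j, b j & s j]; its last
   point a j.+1 is skipped, being the first point of the next chain. *)
Lemma splice_chains X (a b : nat -> X) :
  (forall j, mdist (a j) (b j) < j.+1%:R^-1) ->
  (forall j, chain_ball (b j) j.+1%:R^-1 (a j.+1)) ->
  exists y k, [/\ quasi_cauchy y, is_subseq_index k &
    forall j, y (k j) = a j /\ y (k j).+1 = b j].
Proof.
move=> ab bc.
have /choice[s sP] j : exists s, path (fun p q => mdist p q < j.+1%:R^-1) (b j) s
    /\ last (b j) s = a j.+1.
  by have [s ? ?] := bc j; exists s.
pose next (c : nat * nat) :=
  if (c.2 < size (s c.1))%N then (c.1, c.2.+1) else (c.1.+1, 0%N).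
pose c n := iter n next (0%N, 0%N).
pose pt (c : nat * nat) := nth (a c.1) [:: a c.1, b c.1 & s c.1] c.2.
(* Chain [i] contributes [(size (s i)).+1] points, its last one being skipped, so [k j] is where
   chain [j] starts. *)
pose k j := (\sum_(i < j) (size (s i)).+1)%N.
have k0 : k 0%N = 0%N by rewrite /k big_ord0.
have kS j : k j.+1 = (k j + (size (s j)).+1)%N by rewrite /k big_ord_recr.
have c_le n : ((c n).2 <= size (s (c n).1))%N.
  by elim: n => //= n IH; rewrite /next; case: ifP.
have c_mono m n : (m <= n)%N -> ((c m).1 <= (c n).1)%N.
  move=> /subnK <-; elim: (n - m)%N => // d; rewrite addSn /= /next => IH.
  by case: ifP => //= _; exact: leqW.
have c_chain j i : c (k j) = (j, 0%N) -> (i <= size (s j))%N ->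
    c (k j + i)%N = (j, i).
  move=> ckj; elim: i => [|i IH] ij; first by rewrite addn0.
  by rewrite addnS [LHS]/= -/(c _) IH ?(ltnW ij)// /next /= ij.
have ck j : c (k j) = (j, 0%N).
  elim: j => [|j IH]; first by rewrite k0.
  by rewrite kS addnS [LHS]/= -/(c _) c_chain// /next /= ltnn.
exists (pt \o c), k; split; last 1 first.
- move=> j /=; rewrite -/(c (k j)) ck; split => //.
  (* If [s j] is empty, the point after [a j] is [a j.+1], which then equals [b j]. *)
  rewrite /next /=; case: ifP => //= /negbT; rewrite -leqNgt leqn0 size_eq0.
  by move=> /eqP s0; have [_] := sP j; rewrite s0.
- move=> e e0; have [N _ NP] := near_infty_natSinv_lt (PosNum e0).
  exists (k N) => n /c_mono; rewrite ck /= => /NP /=; apply: lt_trans.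
  rewrite -/(c n); case: (c n) (c_le n) => j i /= ij.
  have [ps ls] := sP j.
  (* Even when [next] enters the following chain, its first point is the skipped last point of chain
     [j]; every step of [y] is thus a step of one chain. *)
  have -> : pt (next (j, i)) = nth (a j) [:: a j, b j & s j] i.+1.
    rewrite /next /=; case: ltnP => //= si; have -> : i = size (s j).
      by apply/eqP; rewrite eqn_leq ij.
    by rewrite -[size (s j)]/((size (b j :: s j)).-1) nth_last.
  rewrite metric_sym.
  have /(pathP (a j))/(_ i) : path (fun p q => mdist p q < j.+1%:R^-1) (a j) (b j :: s j).
    by rewrite /= ab.
  exact.
- by apply: subseq_indexS => j; rewrite kS addnS ltnS leq_addr.
Qed.

Lemma bourbaki_of_complete_closed X :
  (forall A B : set X, complete_set A -> closed B ->
      A !=set0 -> B !=set0 -> A `&` B = set0 -> ~ quasi_cauchy_connected A B) ->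
  forall x : nat -> X, bourbaki_quasi_cauchy x ->
    exists2 k, is_subseq_index k & cauchy_seq (x \o k).
Proof.
move=> h6 x xb; apply: contrapT => nok.
have xn : no_cauchy_subseq x by move=> k kI ck; apply: nok; exists k.
have pos m : 0 < m.+1%:R^-1 :> R by rewrite invr_gt0.
have /choice[N NP] m : exists N, forall n n', (N <= n)%N -> (N <= n')%N ->
    chain_ball (x n) (m.+1%:R^-1) (x n').
  have [N [p pP]] := xb _ (pos m); exists N => n n' /pP pn /pP.
  exact/chain_ball_trans/chain_ball_sym.
(* [F m] is past [N i] for all [i <= m], so a chain with steps below [i.+1%:R^-1] leads from [v i]
   to every later [v m]. *)
pose F m := (m + \sum_(i < m.+1) N i)%N.
have FI : is_subseq_index F.
  apply: subseq_indexS => m; rewrite /F [(\sum_(i < m.+2) _)%N]big_ord_recr /=.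
  by rewrite addSn ltnS leq_add2l leq_addr.
have FN i m : (i <= m)%N -> (N i <= F m)%N.
  rewrite -ltnS => im; rewrite /F (bigD1 (Ordinal im))//= addnCA; exact: leq_addr.
pose v := x \o F.
have vn : no_cauchy_subseq v by exact: no_cauchy_subseq_comp.
have vchain i m : (i <= m)%N -> chain_ball (v i) i.+1%:R^-1 (v m).
  by move=> im; apply: NP; exact: FN.
(* Some later term of [v] differs from [v i], and the fine chain towards it must leave [v i] by a
   short step. *)
have /choice[z zP] i : exists z, z <> v i /\ mdist (v i) z < i.+1%:R^-1.
  have [M MP] := no_cauchy_subseq_neq (v i) vn.
  have [|z zv vz] := chain_ball_neighbor (vchain i _ (leq_maxl i M)); last by exists z.
  by move=> /esym; apply: MP; exact: leq_maxr.
have vz : asymptotic v z by apply: asymptotic_le_inv => i; have [] := zP i.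
have zn := no_cauchy_subseq_asymptotic vz vn.
(* Each point of one sequence is eventually avoided by the other, so thinning separates the terms of
   distinct index; [zP] separates those of equal index. *)
have [|k kI kP] := @eventually_rel_subseq (fun i m => v i <> z m /\ z i <> v m).
  move=> i; have [M MP] := no_cauchy_subseq_neq (v i) zn.
  have [M' MP'] := no_cauchy_subseq_neq (z i) vn.
  by exists (maxn M M') => m; rewrite geq_max => /andP[/MP ? /MP' ?].
have vkc := no_cauchy_subseq_complete (no_cauchy_subseq_comp kI vn).
have zkc := no_cauchy_subseq_complete (no_cauchy_subseq_comp kI zn).
have le_inv j : (k j).+1%:R^-1 <= j.+1%:R^-1 :> R.
  by rewrite lef_pV2 ?posrE// ler_nat ltnS subseq_index_ge.
have vzk j : mdist (v (k j)) (z (k j)) < j.+1%:R^-1.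
  by apply: lt_le_trans (le_inv j); have [] := zP (k j).
apply: (h6 _ _ vkc (complete_set_closed zkc)).
- by exists (v (k 0%N)); exists 0%N.
- by exists (z (k 0%N)); exists 0%N.
- apply/seteqP; split => // p [[i _ <-] [j _]] /=.
  by case: (ltngtP i j) => [/kP[vz' _] /esym|/kP[_ zv'] //|->]//; have [] := zP (k j).
- have [|y [l [yq lI yl]]] := @splice_chains _ (v \o k) (z \o k) vzk.
    (* The chain from [z (k j)] first goes back to [v (k j)]. *)
    move=> j /=; apply: (@chain_ball_trans _ _ (v (k j))).
      by apply/chain_ball_sym/chain_ball_step; exact: vzk.
    by apply: chain_ball_le (le_inv j) _; apply: vchain; rewrite ltnW// kI.
  by exists y, l; split => // j; have [-> ->] := yl j; split; exists j.
Qed.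

End Chains.

(** * Distance to a set and separating functions *)

Section SeparatingFunction.
Variables (R : realType) (X : metricType R).

Definition dist_set (A : set X) (x : X) : R := inf (mdist x @` A).

Lemma dist_set_lbound (A : set X) x : has_lbound (mdist x @` A).
Proof. by exists 0 => _ [a _ <-]; exact: mdist_ge0. Qed.

Lemma dist_set_le (A : set X) x a : A a -> dist_set A x <= mdist x a.
Proof. by move=> Aa; apply: (ge_inf (dist_set_lbound A x)); exists a. Qed.

Lemma dist_set_ge0 (A : set X) x : A !=set0 -> 0 <= dist_set A x.
Proof.
move=> [a Aa]; apply: lb_le_inf; first by exists (mdist x a), a.
by move=> _ [b _ <-]; exact: mdist_ge0.
Qed.

Lemma dist_set_mem (A : set X) x : A x -> dist_set A x = 0.
Proof.
move=> Ax; apply/eqP; rewrite eq_le dist_set_ge0 ?andbT; last by exists x.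
by rewrite -(mdistxx x) dist_set_le.
Qed.

Lemma dist_set_adherent (A : set X) x (e : R) : A !=set0 -> 0 < e ->
  exists2 a, A a & mdist x a < dist_set A x + e.
Proof.
move=> [a Aa] e0.
have [|_ [b Ab <-] xb] := @inf_adherent _ (mdist x @` A) e e0; last by exists b.
by split; [exists (mdist x a), a | exact: dist_set_lbound].
Qed.

Lemma dist_set_lipschitz (A : set X) x y : A !=set0 ->
  `|dist_set A x - dist_set A y| <= mdist x y.
Proof.
move=> A0.
have half p q : dist_set A p <= dist_set A q + mdist p q.
  apply/ler_addgt0Pr => e e0; have [a Aa qa] := dist_set_adherent q A0 e0.
  have := dist_set_le p Aa; have := metric_triangle p q a; lra.
have := half x y; have := half y x; rewrite (metric_sym y x) ler_norml.
by move=> *; apply/andP; split; lra.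
Qed.

(** Being 1-Lipschitz, the distance to [A] turns Cauchy sequences into Cauchy sequences of reals,
    and [R] is complete. *)
Lemma dist_set_cvg (A : set X) (x : nat -> X) : A !=set0 -> cauchy_seq x ->
  exists2 l : R, 0 <= l & dist_set A \o x @ \oo --> l.
Proof.
move=> A0 /cauchy_seqP cx.
have /cauchy_cvgP/cvg_ex[l xl] : cauchy (dist_set A \o x @ \oo : set_system R^o).
  apply/(@cauchy_seqP R R^o) => e /cx[N NP]; exists N => m n mN nN.
  by apply: le_lt_trans (NP _ _ nN mN); exact: dist_set_lipschitz.
exists l => //.
have <- : lim (dist_set A \o x @ \oo) = l by exact/cvg_lim.
apply: limr_ge; first by apply/cvg_ex; exists l.
by apply: nearW => n; exact: dist_set_ge0.
Qed.

Lemma dist_set_cvg0 (A : set X) (x : nat -> X) : A !=set0 ->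
  dist_set A \o x @ \oo --> (0 : R) ->
  exists2 a : nat -> X, forall n, A (a n) & asymptotic x a.
Proof.
move=> A0 /(@cvg_seqP R R^o) x0.
(* The infimum need not be attained; the slack [n.+1%:R^-1] vanishes in the limit. *)
have /choice[a aP] n : exists a, A a /\ mdist (x n) a < dist_set A (x n) + n.+1%:R^-1.
  have [|a] := @dist_set_adherent A (x n) n.+1%:R^-1 A0; last by exists a.
  by rewrite invr_gt0.
exists a => [n|e e0]; first by have [] := aP n.
have e2 : 0 < e / 2 by rewrite divr_gt0.
have [N NP] := x0 _ e2; have [M _ MP] := near_infty_natSinv_lt (PosNum e2).
exists (maxn N M) => n; rewrite geq_max => /andP[/NP + /MP /= Mn].
rewrite /mdist/= subr0 ger0_norm ?dist_set_ge0// => Nn; have [_ xan] := aP n.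
by rewrite (lt_trans xan)// (splitr e) ltrD.
Qed.

(* The quotient is Cauchy continuous because along a Cauchy sequence the two
   distances cannot both tend to 0: interleaving nearby points of [A] and [B]
   would give a Cauchy sequence meeting both sets infinitely often. *)
Lemma separating_function (A B : set X) : A !=set0 -> B !=set0 ->
  cauchy_separated A B ->
  exists f : X -> R^o, [/\ cauchy_continuous f,
    forall a, A a -> f a = 0 & forall b, B b -> f b = 1].
Proof.
move=> A0 B0 AB.
have lim_neq0 (x : nat -> X) (l m : R) : cauchy_seq x -> 0 <= l -> 0 <= m ->
    dist_set A \o x @ \oo --> l -> dist_set B \o x @ \oo --> m -> l + m != 0.
  move=> cx l0 m0 xl xm; rewrite paddr_eq0//; apply/negP => /andP[/eqP le0 /eqP me0].
  rewrite le0 in xl; rewrite me0 in xm.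
  have [a Aa xa] := dist_set_cvg0 A0 xl; have [b Bb xb] := dist_set_cvg0 B0 xm.
  have ca := asymptotic_cauchy xa cx.
  have ab := asymptotic_trans (asymptotic_sym xa) xb.
  apply: (AB _ (cauchy_interleave ab ca)); split.
    apply: frequently_infinite => N; exists N.*2; last by rewrite interleave_even.
    by rewrite -addnn leq_addr.
  apply: frequently_infinite => N; exists N.*2.+1; last by rewrite interleave_odd.
  by rewrite -addnn leqW// leq_addr.
exists (fun x => dist_set A x / (dist_set A x + dist_set B x)); split.
- move=> x cx; have [l l0 xl] := dist_set_cvg A0 cx.
  have [m m0 xm] := dist_set_cvg B0 cx.
  apply: (@cvg_cauchy_seq R R^o _ (l / (l + m))).
  apply: (cvgM xl); apply: cvgV; first exact: lim_neq0 xl xm.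
  exact: cvgD.
- by move=> a Aa; rewrite (dist_set_mem Aa) mul0r.
(* [lim_neq0] applied to the constant sequence [b] shows that the denominator is nonzero at [b]. *)
- move=> b Bb; have cb : cauchy_seq (fun=> b : X).
    by apply/cauchy_seqP => e e0; exists 0%N => *; rewrite mdistxx.
  have : dist_set A b + dist_set B b != 0.
    by apply: (lim_neq0 _ _ _ cb); try exact: dist_set_ge0; exact: cvg_cst.
  by rewrite (dist_set_mem Bb) addr0 => ?; rewrite divff.
Qed.

Lemma separated_not_connected (A B : set X) :
  (forall f : X -> R^o, cauchy_continuous f -> ward_continuous f) ->
  A !=set0 -> B !=set0 -> cauchy_separated A B -> ~ quasi_cauchy_connected A B.
Proof.
move=> h2 A0 B0 /(separating_function A0 B0)[f [fc fA fB]] [x [k [xq kI xk]]].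
(* The tolerance 1 is exactly the jump of [f] between [A] and [B]. *)
have [N NP] := h2 f fc x xq 1 ltr01.
have [Ak Bk] := xk N; have := NP _ (subseq_index_ge kI N).
by rewrite /mdist/= (fA _ Ak) (fB _ Bk) sub0r normrN normr1 ltxx.
Qed.

End SeparatingFunction.

(** * Transfer to the completion *)

Section Completion.
Variables (R : realType) (X Xhat : metricType R) (iota : X -> Xhat).
Hypothesis iota_iso : forall a b : X, mdist (iota a) (iota b) = mdist a b.

Lemma cauchy_seq_isometry (x : nat -> X) :
  cauchy_seq (iota \o x) <-> cauchy_seq x.
Proof.
split=> /cauchy_seqP cx; apply/cauchy_seqP => e /cx[N NP]; exists N => m n mN nN.
  by rewrite -iota_iso NP.
by rewrite /= iota_iso NP.
Qed.

Lemma bourbaki_isometry (x : nat -> X) :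
  bourbaki_quasi_cauchy x -> bourbaki_quasi_cauchy (iota \o x).
Proof.
move=> xb e /xb[N [p NP]]; exists N, (iota p) => n /NP[s ps xn].
exists (map iota s); last by rewrite last_map xn.
by rewrite path_map; apply: sub_path ps => a b /=; rewrite iota_iso.
Qed.

Hypothesis iota_dense : dense (range iota).

Lemma dense_approx (p : Xhat) (e : R) : 0 < e ->
  exists a : X, mdist p (iota a) < e.
Proof.
(* Density concerns open sets, hence the interior of the ball. *)
move=> e0; have [||p0 [pp0 [a _ iota_a]]] := iota_dense (O := (ball p e)^°).
- exists p; apply: nbhsx_ballx; exact: e0.
- exact: open_interior.
- by move: (interior_subset pp0); rewrite ballEmdist -iota_a; exists a.
Qed.

(** Every point of the chain is replaced by a point of [X] within [e / 3]; a new step costs two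
    approximations and one old step. *)
Lemma chain_ball_approx (p q : Xhat) (a b : X) (e : R) : 0 < e ->
  chain_ball p (e / 3) q -> mdist p (iota a) < e / 3 ->
  mdist q (iota b) < e / 3 -> chain_ball a e b.
Proof.
move=> e0 [s + <-]; have e3 : 0 < e / 3 by rewrite divr_gt0.
elim: s p a => [|r s IH] p a /=.
  move=> _ pa pb; apply: chain_ball_step; rewrite -iota_iso.
  by have := metric_triangle (iota a) p (iota b); rewrite (metric_sym (iota a) p); lra.
move=> /andP[pr rs] pa qb; have [c rc] := dense_approx r e3.
apply: chain_ball_trans (IH _ _ rs rc qb); apply: chain_ball_step.
rewrite -iota_iso; have := metric_triangle (iota a) p (iota c).
have := metric_triangle p r (iota c); rewrite (metric_sym (iota a) p); lra.
Qed.

Hypothesis Xhat_complete : complete_set [set: Xhat].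

Lemma bourbaki_complete_completion :
  (forall x : nat -> X, bourbaki_quasi_cauchy x ->
     exists2 k, is_subseq_index k & cauchy_seq (x \o k)) <->
  bourbaki_quasi_complete Xhat.
Proof.
split=> [h3 x xb|h4 x xb]; last first.
  have [k [l [kI xl]]] := h4 _ (bourbaki_isometry xb).
  by exists k => //; apply/cauchy_seq_isometry; exact: cvg_cauchy_seq xl.
(* [x] is shadowed by a sequence [y] of [X], which is again Bourbaki quasi-Cauchy by
   [chain_ball_approx]. *)
have /choice[y yP] n : exists y, mdist (x n) (iota y) < n.+1%:R^-1.
  by apply: dense_approx; rewrite invr_gt0.
have xy := asymptotic_le_inv yP.
have [|k kI cyk] := h3 y.
  move=> e e0; have e3 : 0 < e / 3 by rewrite divr_gt0.
  have [N [p NP]] := xb _ e3; have [M MP] := xy _ e3.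
  have [a pa] := dense_approx p e3.
  exists (maxn N M), a => n; rewrite geq_max => /andP[/NP pn /MP xyn].
  exact: chain_ball_approx pn pa xyn.
have [//|l _ ykl] := Xhat_complete _ (iffRL (cauchy_seq_isometry _) cyk).
have yxk := asymptotic_subseq kI (asymptotic_sym xy).
by exists k, l; split => //; exact: asymptotic_cvg yxk ykl.
Qed.

End Completion.

Theorem theorem3p5 (R : realType) (X : metricType R)
    (Xhat : metricType R) (iota : X -> Xhat) (hXhat : is_completion iota) :
  [<->
    (* (1) *)
    forall (Y : metricType R) (f : X -> Y),
      cauchy_continuous f -> ward_continuous f;
    (* (2) *)
    forall f : X -> R^o, cauchy_continuous f -> ward_continuous f;
    (* (3) *)
    forall x : nat -> X, bourbaki_quasi_cauchy x ->
      exists2 k : nat -> nat, is_subseq_index k & cauchy_seq (x \o k);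
    (* (4) *)
    bourbaki_quasi_complete Xhat;
    (* (5) *)
    forall A B : set X, A !=set0 -> B !=set0 ->
      cauchy_separated A B -> ~ quasi_cauchy_connected A B;
    (* (6) *)
    forall A B : set X, complete_set A -> closed B ->
      A !=set0 -> B !=set0 -> A `&` B = set0 -> ~ quasi_cauchy_connected A B].
Proof.
have [iota_iso iota_dense Xhat_complete] := hXhat.
have h34 := bourbaki_complete_completion iota_iso iota_dense Xhat_complete.
have h25 (h2 : forall f : X -> R^o, cauchy_continuous f -> ward_continuous f)
    (A B : set X) := @separated_not_connected R X A B h2.
have h31 h3 (Y : metricType R) (f : X -> Y) := @bourbaki_ward R X Y f h3.
have h56 (h5 : forall A B : set X, A !=set0 -> B !=set0 ->
      cauchy_separated A B -> ~ quasi_cauchy_connected A B)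
    (A B : set X) (Ac : complete_set A) (Bc : closed B)
    (A0 : A !=set0) (B0 : B !=set0) (AB0 : A `&` B = set0) :=
  h5 A B A0 B0 (separated_of_complete_closed Ac Bc AB0).
have h63 := @bourbaki_of_complete_closed R X.
(* The cycle is required in the listed order: (2) reaches (3) through (5) and (6), (4) reaches (5)
   through (3), (1) and (2), and (6) reaches (1) through (3). *)
tfae.
- by move=> h1 f; exact: h1.
- by move=> /h25/h56/h63.
- exact: (h34.1).
- by move=> /h34/h31 h1; apply: h25 => f; exact: h1.
- exact: h56.
- by move=> /h63/h31.
Qed.
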